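(* Let $X$ be reflexive, $X_d$ be an RCB-space, and $V$ be a bounded operator, from $X^*$ into $X^*$ for (i)-(iv) and from $X$ into $X$ for (v). Then the following statements hold. (i) Let $(g_i)_{i=1}^\infty$ be an $X_d$-Bessel sequence for $X$. Then $(Vg_i)_{i=1}^\infty$ is an $X_d$-Bessel sequence for $X$. (ii) Let $(g_i)_{i=1}^\infty$ be an $X_d$-frame for $X$. The sequence $(Vg_i)_{i=1}^\infty$ is an $X_d$-frame for $X$ if and only if $V$ is surjective. (iii) Let $(g_i)_{i=1}^\infty$ be a Banach frame for $X$ with respect to $X_d$. The sequence $(Vg_i)_{i=1}^\infty$ is a Banach frame for $X$ with respect to $X_d$ if and only if $V$ is surjective and has a bounded right inverse $W:X^*\to X^*$. (iv) Let $(g_i)_{i=1}^\infty$ in $X^*$ be such that there exists a sequence $(f_i)_{i=1}^\infty$ in $X$ for which $((g_i)_{i=1}^\infty,(f_i)_{i=1}^\infty)$ is an atomic decomposition of $X$ with respect to $X_d$, and let $U:X\to X_d$, $Uf=(g_i(f))_{i=1}^\infty$. There exists a sequence $(h_i)_{i=1}^\infty$ in $X$ such that $((Vg_i)_{i=1}^\infty,(h_i)_{i=1}^\infty)$ is an atomic decomposition of $X$ with respect to $X_d$ if and only if $V$ is surjective and $UV^*$ has a left inverse $L:\mathcal{D}(L)(\subseteq X_d)\to X$ with $\mathcal{D}(L)$ being a linear subset of $X_d$ satisfying $\mathcal{D}(L)\supseteq\mathrm{span}\{\delta_i\}\cup\mathcal{R}(UV^* )$ and $$L\Big(\sum_{i=1}^n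 (Vg_i)(f)\,\delta_i\Big)\to L\Big(\sum_{i=1}^\infty (Vg_i)(f)\,\delta_i\Big)\quad\text{as } n\to\infty,\ \text{for every } f\in X.$$ (v) Let $(f_i)_{i=1}^\infty$ be an $X_d$-Riesz basis for $X$. The sequence $(Vf_i)_{i=1}^\infty$ is an $X_d$-Riesz basis for $X$ if and only if $V$ is bijective.
   Context: $X$ is an infinite-dimensional separable Banach space with dual $X^*$; as $X$ is reflexive, $X^{**}$ is identified with $X$ (so $V^*:X\to X$ when $V:X^*\to X^*$). ''Operator'' means linear mapping; left and right inverses are linear; $\mathcal{D}(L)$ and $\mathcal{R}(L)$ are the domain and range of an operator $L$; $\mathrm{span}$ denotes the set of all finite linear combinations. $X_d$ is a Banach sequence space (a Banach space of scalar sequences). It is a CB-space if the canonical vectors form a Schauder basis $(\delta_i)_{i=1}^\infty$ of $X_d$ (so $(c_i)=\sum c_i\delta_i$ for all $(c_i)\in X_d$); an RCB-space if it is a reflexive CB-space. Let $g_i\in X^*$, $i\in\mathbb{N}$. Consider the conditions: (a) $(g_i(f))_{i=1}^\infty\in X_d$ for all $f\in X$; (b) there are positive constants $A,B$ with $A\|f\|_X\le\|(g_i(f))_{i=1}^\infty\|_{X_d}\le B\|f\|_X$ for all $f\in X$; (c) there is a bounded operator $Q:X_d\to X$ with $Q(g_i(f))_{i=1}^\infty=f$ for all $f\in X$. The sequence $(g_i)$ is an $X_d$-frame for $X$ if (a) and (b) hold; an $X_d$-Bessel sequence for $X$ if (a) and the upper inequality in (b) hold; a Banach frame for $X$ with respect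 to $X_d$ if (a), (b), (c) hold. For $f_i\in X$, the pair $((g_i),(f_i))$ is an atomic decomposition of $X$ with respect to $X_d$ if (a), (b) hold and $f=\sum_{i=1}^\infty g_i(f)f_i$ (norm convergence) for all $f\in X$. A sequence $(y_i)_{i=1}^\infty$ in a Banach space $Y$ is an $X_d$-Riesz basis for $Y$ if it is complete in $Y$ (its linear span is dense) and there are constants $A,B>0$ such that $A\|(c_i)\|_{X_d}\le\|\sum_{i=1}^\infty c_iy_i\|_Y\le B\|(c_i)\|_{X_d}$ for all $(c_i)_{i=1}^\infty\in X_d$ (in particular, the series converge). *)

(* Defs.v *)
From HB Require Import structures.
From mathcomp Require Import all_boot all_order all_algebra.
From mathcomp Require Import complex.
From mathcomp Require Import all_classical all_reals all_analysis.

Set Implicit Arguments.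
Unset Strict Implicit.
Unset Printing Implicit Defensive.

Import Order.TTheory GRing.Theory Num.Theory.
Import numFieldNormedType.Exports.

Local Open Scope classical_set_scope.
Local Open Scope ring_scope.

(* The scalar field is either R or C = R[i]; norms take values in it, and in
   R[i] the order is such that [0 <= x] forces [x] to be real. *)
Variant scalar_kind := RealScalars | ComplexScalars.

Definition scalars (R : realType) (k : scalar_kind) : numFieldType :=
  match k with RealScalars => R | ComplexScalars => R[i] end.

Definition of_real (R : realType) (k : scalar_kind) : R -> scalars R k :=
  match k with RealScalars => id | ComplexScalars => real_complex R end.
Arguments of_real {R k}.

Definition real_part (R : realType) (k : scalar_kind) : scalars R k -> R :=
  match k with RealScalars => id | ComplexScalars => @complex.Re R end.
Arguments real_part {R k}.

Section ScalarTheory.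
Context {R : realType} {k : scalar_kind}.
Local Notation K := (scalars R k).

Lemma of_real_le (x y : R) : ((of_real x : K) <= of_real y) = (x <= y).
Proof. by case: k => //=; rewrite lecR. Qed.

Lemma of_realD (x y : R) : of_real (x + y) = of_real x + of_real y :> K.
Proof. by case: k => //=; rewrite rmorphD. Qed.

Lemma of_realM (x y : R) : of_real (x * y) = of_real x * of_real y :> K.
Proof. by case: k => //=; rewrite rmorphM. Qed.

Lemma of_real0 : of_real 0 = 0 :> K.
Proof. by case: k. Qed.

Lemma of_realK (x : R) : real_part (of_real x : K) = x.
Proof. by case: k. Qed.

Lemma real_partK (x : K) : 0 <= x -> of_real (real_part x) = x.
Proof. by case: k x => [//|[a b]] /=; rewrite lecE /= => /andP[/eqP-> _]. Qed.

End ScalarTheory.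

Section BoundedOperator.
Context {K : numFieldType} {E F : normedModType K}.

Definition bounded_operator (f : {linear E -> F}) :=
  exists M : K, forall x, `|f x| <= M * `|x|.

Lemma bounded_operatorP (f : {linear E -> F}) :
  bounded_operator f <-> bounded_near f (nbhs (0 : E)).
Proof.
split=> [[M fM]|/linear_boundedP/pinfty_ex_gt0[M _ fM]]; last by exists M.
have {}fM x : `|f x| <= `|M| * `|x|.
  have Mx : M * `|x| \is Num.real.
    exact/ger0_real/(le_trans _ (fM x)).
  apply: le_trans (fM x) _.
  by rewrite (le_trans (real_ler_norm Mx))// normrM normr_id.
apply/linear_boundedP; exists `|M|; split; first exact: normr_real.
move=> r /ltW Mr x; apply: (le_trans (fM x)).
exact: ler_wpM2r.
Qed.

End BoundedOperator.

Section Dual.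
Context {R : realType} {k : scalar_kind}.
Local Notation K := (scalars R k).
Variable X : normedModType K.

Definition bounded_functional : {pred X -> K^o} := fun f =>
  `[< linear f /\ exists M : K, forall x, `|f x| <= M * `|x| >].

Record dual_space := Dual {
  dual_val :> X -> K^o ;
  dual_valP : bounded_functional dual_val }.

HB.instance Definition _ := [isSub for dual_val].
HB.instance Definition _ := [Choice of dual_space by <:].

Lemma bounded_functional_submod : submod_closed bounded_functional.
Proof.
split=> [|a f g].
  rewrite unfold_in; apply/asboolP; split=> [b x y|].
    by change (0 = b *: 0 + 0 :> K^o); rewrite scaler0 addr0.
  by exists 0 => x; change (`|0 : K^o| <= 0 * `|x|); rewrite normr0 mul0r.
rewrite !unfold_in => /asboolP[lf [M fM]] /asboolP[lg [N gN]].
apply/asboolP; split=> [b x y|].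
  change (a *: f (b *: x + y) + g (b *: x + y) =
    b *: (a *: f x + g x) + (a *: f y + g y)).
  rewrite lf lg !scalerDr !scalerA (mulrC a b) -!addrA; congr (_ + _).
  by rewrite addrCA.
exists (`|a| * M + N) => x.
change (`|a *: f x + g x| <= (`|a| * M + N) * `|x|).
rewrite (le_trans (ler_normD _ _))// mulrDl lerD//.
by rewrite normrZ -mulrA ler_wpM2l.
Qed.

HB.instance Definition _ :=
  GRing.isSubmodClosed.Build K (X -> K^o) bounded_functional
    bounded_functional_submod.
HB.instance Definition _ := [SubChoice_isSubLmodule of dual_space by <:].

Lemma dual_linear (g : dual_space) : linear (g : X -> K^o).
Proof. by have /asboolP[] := dual_valP g. Qed.

HB.instance Definition _ (g : dual_space) :=
  GRing.isLinear.Build K X K^o *:%R (dual_val g) (dual_linear g).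

Lemma dual_bounded (g : dual_space) :
  exists M : K, forall x, `|g x| <= M * `|x|.
Proof. by have /asboolP[] := dual_valP g. Qed.

Lemma dual_eqP (g h : dual_space) : g = h <-> forall x, g x = h x.
Proof. by split=> [->//|gh]; apply: val_inj; apply/funext. Qed.

Lemma dual_addE (g h : dual_space) x : (g + h) x = g x + h x.
Proof. by []. Qed.

Lemma dual_scaleE (a : K) (g : dual_space) x : (a *: g) x = a *: g x.
Proof. by []. Qed.

Let unit_values (g : dual_space) : set R :=
  [set real_part `|g x| | x in [set x | `|x| <= 1]].

Definition dual_norm (g : dual_space) : K := of_real (sup (unit_values g)).

Lemma unit_values_sup (g : dual_space) : has_sup (unit_values g).
Proof.
split; first by exists (real_part `|g 0|), 0 => //=; rewrite normr0.
have [M gM] := dual_bounded g.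
exists (real_part `|M|) => _ [x /= x1 <-].
rewrite -(@of_real_le R k) !real_partK// (le_trans (gM x))//.
have Mx : M * `|x| \is Num.real by exact/ger0_real/(le_trans _ (gM x)).
by rewrite (le_trans (real_ler_norm Mx))// normrM normr_id ler_piMr.
Qed.

Lemma dual_normP (g : dual_space) x : `|g x| <= dual_norm g * `|x|.
Proof.
have [->|x0] := eqVneq x 0; first by rewrite linear0 !normr0 mulr0.
rewrite -ler_pdivrMr ?normr_gt0//.
have -> : `|g x| / `|x| = `|g (`|x|^-1 *: x)|.
  by rewrite linearZ/= normrZ normfV normr_id mulrC.
rewrite -[leLHS]real_partK// /dual_norm of_real_le.
apply: ub_le_sup; first by have [] := unit_values_sup g.
by exists (`|x|^-1 *: x) => //=; rewrite normfZV.
Qed.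

Lemma dual_norm_le (g : dual_space) (M : K) :
  (forall x, `|x| <= 1 -> `|g x| <= M) -> dual_norm g <= M.
Proof.
move=> gM; have M0 : 0 <= M by rewrite (le_trans _ (gM 0 _)) ?normr0.
rewrite -(real_partK M0) /dual_norm of_real_le; apply: ge_sup.
  by have [] := unit_values_sup g.
move=> _ [x /= x1 <-].
by rewrite -(@of_real_le R k) !real_partK// gM.
Qed.

Lemma dual_norm_ge0 (g : dual_space) : 0 <= dual_norm g.
Proof.
rewrite /dual_norm -of_real0 of_real_le.
have [_ ub] := unit_values_sup g.
apply: le_trans (ub_le_sup ub _) => /=; last first.
  by exists 0; [rewrite /= normr0|reflexivity].
by rewrite -(@of_real_le R k) of_real0 real_partK.
Qed.

Lemma dual_norm_triangle (g h : dual_space) :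
  dual_norm (g + h) <= dual_norm g + dual_norm h.
Proof.
apply: dual_norm_le => x x1; rewrite dual_addE (le_trans (ler_normD _ _))//.
by rewrite lerD// (le_trans (dual_normP _ _))// ler_piMr// dual_norm_ge0.
Qed.

Lemma dual_normZ_le (a : K) (g : dual_space) :
  dual_norm (a *: g) <= `|a| * dual_norm g.
Proof.
apply: dual_norm_le => x x1; rewrite dual_scaleE normrZ ler_wpM2l//.
by rewrite (le_trans (dual_normP _ _))// ler_piMr// dual_norm_ge0.
Qed.

Lemma dual_normZ (a : K) (g : dual_space) :
  dual_norm (a *: g) = `|a| * dual_norm g.
Proof.
apply/eqP; rewrite eq_le dual_normZ_le/=.
have [->|a0] := eqVneq a 0; first by rewrite normr0 mul0r dual_norm_ge0.
rewrite -ler_pdivlMl ?normr_gt0// -normfV.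
by rewrite (le_trans _ (dual_normZ_le _ _))// scalerA mulVf// scale1r.
Qed.

Lemma dual_norm0_eq0 (g : dual_space) : dual_norm g = 0 -> g = 0.
Proof.
move=> g0; apply/dual_eqP => x; apply/normr0_eq0/eqP.
by rewrite eq_le normr_ge0 andbT (le_trans (dual_normP g x))// g0 mul0r.
Qed.

HB.instance Definition _ := Lmodule_isNormed.Build K dual_space
  dual_norm_triangle dual_normZ dual_norm0_eq0.

Lemma dual_normE (g : dual_space) : `|g| = dual_norm g.
Proof. by []. Qed.

End Dual.

Section Adjoint.
Context {R : realType} {k : scalar_kind}.
Local Notation K := (scalars R k).

Lemma eval_subproof (E : normedModType K) (x : E) :
  bounded_functional (fun g : dual_space E => g x).
Proof.
apply/asboolP; split=> [a g h|]; first by rewrite dual_addE dual_scaleE.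
by exists `|x| => g; rewrite mulrC; exact: dual_normP.
Qed.

Definition bidual_embedding (E : normedModType K) (x : E) :
    dual_space (dual_space E) :=
  Dual (eval_subproof x).

Definition reflexive_space (E : normedModType K) :=
  range (@bidual_embedding E) = [set: dual_space (dual_space E)].

Lemma adjoint_subproof (E F : normedModType K) (V : {linear E -> F})
  (bV : bounded_operator V) (g : dual_space F) :
  bounded_functional (fun x => g (V x)).
Proof.
apply/asboolP; split=> [a x y|]; first by rewrite linearP dual_linear.
have [M VM] := bV; exists (`|g| * M) => x.
apply: le_trans (dual_normP _ _) _.
rewrite -(mulrA `|g|); apply: ler_wpM2l; [exact: dual_norm_ge0|exact: VM].
Qed.

Definition adjoint (E F : normedModType K) (V : {linear E -> F})
  (bV : bounded_operator V) (g : dual_space F) : dual_space E :=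
  Dual (adjoint_subproof bV g).

(* For reflexive X and V : X^* -> X^*, the adjoint V^* : X^** -> X^** seen as
   a map X -> X through the identification of X^** with X. *)
Definition adjoint_on (X : normedModType K)
    (V : {linear dual_space X -> dual_space X}) (bV : bounded_operator V)
    (x : X) : X :=
  xget 0 [set y | bidual_embedding y = adjoint bV (bidual_embedding x)].

End Adjoint.

Section Bases.
Context {K : numFieldType} {E : normedModType K}.

Definition infinite_dimensional := ~ exists n (b : 'I_n -> E),
  forall x, exists a : 'I_n -> K, x = \sum_(i < n) a i *: b i.

Definition separable_space := exists2 D : set E, countable D & dense D.

Definition lin_span (y : nat -> E) : set E :=
  [set x | exists n (a : nat -> K), x = \sum_(i < n) a i *: y i].

Definition expansion (a : nat -> K) (y : nat -> E) : nat -> E :=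
  series (fun i => a i *: y i).

Definition schauder_basis (y : nat -> E) :=
  forall x : E, exists! a : nat -> K, expansion a y @ \oo --> x.

End Bases.
Arguments infinite_dimensional {K} E.
Arguments separable_space {K} E.

(* A Banach space of scalar sequences, presented as a Banach space together
   with an injective linear map sending each element to its sequence of
   terms.  As the terms need not depend continuously on the element, the
   expansion of an element in the basis of canonical vectors could a priori
   have coefficients other than its terms: [CB_space] excludes this. *)
Record banachSeqSpace (K : numFieldType) := BanachSeqSpace {
  seq_space :> completeNormedModType K ;
  terms : {linear seq_space -> (nat -> K^o)} ;
  terms_inj : injective terms }.
Arguments terms {K _}.

Section SequenceSpace.
Context {K : numFieldType} (Xd : banachSeqSpace K).

Definition in_space (c : nat -> K) := exists x : Xd, terms x = c.

(* The sequence c as an element of Xd; junk value 0 unless [in_space c]. *)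
Definition to_space (c : nat -> K) : Xd := xget 0 [set x | terms x = c].

Lemma to_spaceK (c : nat -> K) : in_space c -> terms (to_space c) = c.
Proof. by move=> h; apply: (@xgetPex _ (0 : Xd) [set x : Xd | terms x = c]). Qed.

Definition canonical_seq (i j : nat) : K := (j == i)%:R.

Definition canonical_vector (i : nat) : Xd := to_space (canonical_seq i).

Definition CB_space :=
  [/\ forall i, in_space (canonical_seq i),
      schauder_basis canonical_vector &
      forall c : Xd, expansion (terms c) canonical_vector @ \oo --> c].

End SequenceSpace.

Definition RCB_space (R : realType) (k : scalar_kind)
    (Xd : banachSeqSpace (scalars R k)) :=
  CB_space Xd /\ reflexive_space Xd.

Section Frames.
Context {R : realType} {k : scalar_kind}.
Local Notation K := (scalars R k).
Context {X : completeNormedModType K} (Xd : banachSeqSpace K).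
Implicit Types (g : nat -> dual_space X) (f : X).

Definition coefficients g f : nat -> K := fun i => g i f.

Definition analysis g f : Xd := to_space Xd (coefficients g f).

Definition coefficients_in g := forall f, in_space Xd (coefficients g f).

Definition Bessel_sequence g :=
  coefficients_in g /\
  exists2 B : K, 0 < B & forall f, `|analysis g f| <= B * `|f|.

Definition frame g :=
  coefficients_in g /\
  exists A B : K, [/\ 0 < A, 0 < B &
    forall f, A * `|f| <= `|analysis g f| <= B * `|f| ].

Definition Banach_frame g :=
  frame g /\ exists2 Q : {linear Xd -> X}, bounded_operator Q &
    forall f, Q (analysis g f) = f.

Definition atomic_decomposition g (y : nat -> X) :=
  frame g /\ forall f, expansion (coefficients g f) y @ \oo --> f.

End Frames.

Definition Riesz_basis (K : numFieldType) (Xd : banachSeqSpace K)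
    (Y : completeNormedModType K) (y : nat -> Y) :=
  dense (lin_span y) /\
  exists A B : K, [/\ 0 < A, 0 < B &
    forall c : Xd, cvgn (expansion (terms c) y) /\
      A * `|c| <= `|limn (expansion (terms c) y)| <= B * `|c| ].

Section PartialOperators.
Context {K : numFieldType} {E F : normedModType K}.

Definition linear_subset (D : set E) :=
  D 0 /\ forall (a : K) x y, D x -> D y -> D (a *: x + y).

(* An operator with domain D is a function on E of which only the values on D
   matter. *)
Definition linear_on (D : set E) (L : E -> F) :=
  forall (a : K) x y, D x -> D y -> L (a *: x + y) = a *: L x + L y.

End PartialOperators.

(* Main.v *)
Require Import Defs.
From HB Require Import structures.
From mathcomp Require Import all_boot all_order all_algebra.
From mathcomp Require Import complex.
From mathcomp Require Import all_classical all_reals all_analysis.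
From mathcomp Require Import ring lra.

Set Implicit Arguments.
Unset Strict Implicit.
Unset Printing Implicit Defensive.

Import Order.TTheory GRing.Theory Num.Theory.
Import numFieldNormedType.Exports.

Local Open Scope classical_set_scope.
Local Open Scope ring_scope.

(** Every coefficient of the image sequence satisfies (V g_i)(f) = g_i(V^* f),
    where V^* : X -> X is the adjoint of V read through the reflexivity of X.
    The analysis operator of (V g_i) is therefore U V^*, with U that of (g_i),
    and statements about (V g_i) become statements about V^*:
    [analysis_image].

    Boundedness of V^* gives the Bessel property.  As U is bounded below,
    (V g_i) is a frame exactly when V^* is bounded below, and this is
    equivalent to the surjectivity of V
    ([surjective_iff_adjoint_bounded_below]).  In one direction, every h in
    X^* induces the bounded functional V^* f |-> h(f) on the range of V^*, and
    a Hahn-Banach extension of it is a preimage of h ([adjoint_surjective]).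
    In the other, if V is onto, then the functionals on X^* whose composite
    with V has norm at most one are pointwise bounded, hence uniformly bounded
    ([adjoint_bounded_below]).  For Banach frames, a left inverse Q' of U V^*
    and a right inverse W of V are exchanged by W = (Q' U)^* and Q' = W^* Q.
    For atomic decompositions, the left inverse is c |-> sum c_i h_i on
    the sequences for which the series converges, and conversely
    h_i = L delta_i.

    An X_d-Riesz basis is the image of the canonical basis under an
    isomorphism T from X_d onto the space ([Riesz_basisP]), so the claim on
    Riesz bases asks when V T is an isomorphism.  The only nontrivial point is
    that a bijective V is bounded below ([bijective_bounded_below]).  This too
    follows from uniform boundedness and Hahn-Banach: V^* is bounded below
    because V is onto, and by reflexivity its range is dense because V is
    injective, so a functional that norms x is close to some h o V with h
    bounded independently of x, which forces a lower bound on V x.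

    The scalars are real or complex.  The Hahn-Banach theorem is proved for
    real scalars and transferred by taking real parts; the uniform boundedness
    principle is proved by a gliding hump, which needs only norms and
    completeness. *)

(** * The Hahn-Banach theorem for real scalars *)

Section RealHahnBanach.
Context {R : realType} {E : lmodType R} (p : E -> R).
Hypothesis p_sub : forall x y, p (x + y) <= p x + p y.
Hypothesis p_hom : forall (t : R) x, 0 <= t -> p (t *: x) = t * p x.

(** A partial linear functional is represented by its graph, so that
    the order by extension is inclusion and the union of a chain is its upper
    bound.  Single-valuedness is a consequence of the domination
    ([dominated_graph_fun]). *)
Definition dominated_graph (G : set (E * R)) :=
  [/\ G (0, 0),
      forall t x y r s, G (x, r) -> G (y, s) -> G (t *: x + y, t * r + s) &
      forall x r, G (x, r) -> r <= p x].

Lemma dominated_graphZ G t x r :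
  dominated_graph G -> G (x, r) -> G (t *: x, t * r).
Proof. by move=> [G0 GL _] /(GL t _ _ _ _)/(_ G0); rewrite !addr0. Qed.

Lemma dominated_graph_fun G x r s :
  dominated_graph G -> G (x, r) -> G (x, s) -> r = s.
Proof.
move=> dG; wlog suff le_rs : r s / G (x, r) -> G (x, s) -> r <= s.
  by move=> Gr Gs; apply/eqP; rewrite eq_le !le_rs.
move=> Gr Gs; have [_ GL Gp] := dG.
have := GL (-1) _ _ _ _ Gs Gr; rewrite scaleN1r addNr => /Gp.
have -> : p 0 = 0 by rewrite -(scale0r 0) p_hom// mul0r.
by rewrite mulN1r addrC subr_le0.
Qed.

(** The value [c] at [x0] must satisfy r - p (x - x0) <= c <= p (x' + x0) - r'
    on the graph; subadditivity puts every lower bound below every upper bound,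
    and homogeneity reduces the domination at [x + t *: x0] to these two
    cases. *)
Lemma one_step_extension G x0 : dominated_graph G ->
  exists G' c, [/\ dominated_graph G', G `<=` G' & G' (x0, c)].
Proof.
move=> dG; have [G0 GL Gp] := dG.
pose lows := [set c | exists x r, G (x, r) /\ c = r - p (x - x0)].
have lowsP x r c : G (x, r) -> lows c -> c <= p (x + x0) - r.
  move=> Gxr [y [s [Gys ->]]].
  have := GL 1 _ _ _ _ Gys Gxr; rewrite scale1r mul1r => /Gp.
  have := p_sub (y - x0) (x + x0); rewrite addrACA addNr addr0; lra.
have lows0 : lows !=set0 by exists (0 - p (0 - x0)), 0, 0.
have lows_sup : has_sup lows.
  by split=> //; exists (p (0 + x0) - 0) => c /lowsP; apply.
pose c := sup lows.
have c_ge x r : G (x, r) -> r - p (x - x0) <= c.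
  by move=> Gxr; apply: ub_le_sup; [case: lows_sup|exists x, r].
have c_le x r : G (x, r) -> c <= p (x + x0) - r.
  by move=> Gxr; apply: ge_sup => // d; exact: lowsP.
exists [set z | exists t x r, G (x, r) /\ z = (x + t *: x0, r + t * c)], c.
split; [split|..].
- by exists 0, 0, 0; rewrite scale0r mul0r !addr0.
- move=> t _ _ _ _ [a [x [r [Gxr [-> ->]]]]] [b [y [s [Gys [-> ->]]]]].
  exists (t * a + b), (t *: x + y), (t * r + s); split; first exact: GL.
  congr pair; last by ring.
  by rewrite scalerDr scalerA scalerDl -!addrA; congr (_ + _); rewrite addrCA.
- move=> _ _ [t [x [r [Gxr [-> ->]]]]].
  have [t_lt0|t_gt0|->] := ltgtP t 0.
  + have s_gt0 : 0 < - t by rewrite oppr_gt0.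
    have := c_ge _ _ (dominated_graphZ (- t)^-1 dG Gxr).
    rewrite -(ler_pM2l s_gt0) mulrBr -p_hom ?(ltW s_gt0)//
      mulrA mulfV ?gt_eqF// mul1r.
    rewrite scalerBr scalerA mulfV ?gt_eqF// scale1r scaleNr opprK; lra.
  + have := c_le _ _ (dominated_graphZ t^-1 dG Gxr).
    rewrite -(ler_pM2l t_gt0) mulrBr -p_hom ?(ltW t_gt0)//
      mulrA mulfV ?gt_eqF// mul1r.
    rewrite scalerDr scalerA mulfV ?gt_eqF// scale1r; lra.
  + by rewrite scale0r mul0r !addr0; exact: Gp.
- by move=> [x r] Gxr; exists 0, x, r; rewrite scale0r mul0r !addr0.
- by exists 1, 0, 0; rewrite scale1r mul1r !add0r.
Qed.

Theorem real_Hahn_Banach G0 : dominated_graph G0 ->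
  exists g : E -> R, [/\ forall t x y, g (t *: x + y) = t * g x + g y,
    forall x, g x <= p x & forall x r, G0 (x, r) -> g x = r].
Proof.
move=> dG0.
(* The empty chain forces the empty set to be admissible, hence the maximality
   is taken over the sets whose union with [G0] is a dominated graph. *)
have [|A [dA maxA]] := @Zorn_bigcup _ [set A | dominated_graph (G0 `|` A)].
  move=> F FP totF /=; set H := G0 `|` _.
  have common z w : H z -> H w ->
      exists G, [/\ dominated_graph G, G `<=` H, G z & G w].
    have subH A : F A -> G0 `|` A `<=` H.
      by move=> FA; apply: setUS => v Av; exists A.
    move=> [Gz|[A FA Az]] [Gw|[B FB Bw]].
    - by exists G0; split=> //; exact: subsetUl.
    - by exists (G0 `|` B); split;
        [exact: FP|exact: subH|left|right].
    - by exists (G0 `|` A); split;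
        [exact: FP|exact: subH|right|left].
    - case: (totF _ _ FA FB) => [AB|BA].
      + by exists (G0 `|` B); split;
          [exact: FP|exact: subH|right; exact: AB|right].
      + by exists (G0 `|` A); split;
          [exact: FP|exact: subH|right|right; exact: BA].
  split.
  - by left; case: dG0.
  - move=> t x y r s Hx Hy; have [G [[_ GL _] GH Gx Gy]] := common _ _ Hx Hy.
    exact/GH/GL.
  - by move=> x r Hx; have [G [[_ _ Gp] _ Gx _]] := common _ _ Hx Hx; exact: Gp.
set M := G0 `|` A in dA; have [M0 ML Mp] := dA.
have domM x : exists r, M (x, r).
  have [G' [c [dG' MG' Gxc]]] := one_step_extension x dA.
  apply: contrapT => Mx; apply: (maxA G'); last first.
    by rewrite /= setUidr// => z Gz; apply: MG'; left.
  split; first by move=> z Az; apply: MG'; right.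
  by move=> /(_ _ Gxc) Axc; apply: Mx; exists c; right.
have [g Mg] := choice domM.
exists g; split=> [t x y|x|x r Gxr].
- apply: (dominated_graph_fun dA (Mg _)).
  exact: (ML _ _ _ _ _ (Mg _) (Mg _)).
- exact/Mp/Mg.
- by apply: (dominated_graph_fun dA (Mg _)); left.
Qed.

End RealHahnBanach.

(** * Real and complex scalars, and the Hahn-Banach theorem over both *)

Section RealNorm.
Context {R : realType} {k : scalar_kind}.
Local Notation K := (scalars R k).

Lemma of_real1 : of_real 1 = 1 :> K.
Proof. by case: k. Qed.

Lemma of_realN (x : R) : of_real (- x) = - of_real x :> K.
Proof. by case: k => //=; rewrite rmorphN. Qed.

Lemma of_real_lt (x y : R) : ((of_real x : K) < of_real y) = (x < y).
Proof. by case: k => //=; rewrite ltcR. Qed.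

Lemma of_real_nat (n : nat) : of_real n%:R = n%:R :> K.
Proof. by case: k => //=; rewrite rmorph_nat. Qed.

Lemma of_realV (t : R) : of_real t^-1 = (of_real t)^-1 :> K.
Proof. by case: k => //=; rewrite fmorphV. Qed.

Lemma of_real_norm (t : R) : `|of_real t : K| = of_real `|t|.
Proof. by case: k => //=; rewrite normc_def/= expr0n addr0 sqrtr_sqr. Qed.

Context {E : normedModType K}.

(** The norm as a real number: over the complex numbers the norm takes values
    in a partially ordered field, out of reach of linear arithmetic. *)
Definition rnorm (x : E) : R := real_part `|x|.

Lemma rnormE x : of_real (rnorm x) = `|x|.
Proof. exact: real_partK. Qed.

Lemma rnorm_ge0 x : 0 <= rnorm x.
Proof. by rewrite -(@of_real_le R k) rnormE of_real0. Qed.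

Lemma rnorm0 : rnorm 0 = 0.
Proof. by rewrite /rnorm normr0 -of_real0 of_realK. Qed.

Lemma rnormN x : rnorm (- x) = rnorm x.
Proof. by rewrite /rnorm normrN. Qed.

Lemma rnormD x y : rnorm (x + y) <= rnorm x + rnorm y.
Proof. by rewrite -(@of_real_le R k) of_realD !rnormE ler_normD. Qed.

Lemma rnormZ (t : R) x : rnorm ((of_real t : K) *: x) = `|t| * rnorm x.
Proof.
by rewrite /rnorm normrZ of_real_norm -(rnormE x) -of_realM !of_realK.
Qed.

End RealNorm.

(** Restriction of scalars to the reals. *)
Definition realified (R : realType) (k : scalar_kind)
  (E : lmodType (scalars R k)) : Type := E.

Section Realified.
Context {R : realType} {k : scalar_kind} {E : lmodType (scalars R k)}.

HB.instance Definition _ := GRing.Zmodule.on (@realified R k E).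

Let real_scale (t : R) (x : @realified R k E) : @realified R k E :=
  (of_real t : scalars R k) *: (x : E).

Let real_scaleA s t x : real_scale s (real_scale t x) = real_scale (s * t) x.
Proof. by rewrite /real_scale scalerA of_realM. Qed.

Let real_scale1 x : real_scale 1 x = x.
Proof. by rewrite /real_scale of_real1 scale1r. Qed.

Let real_scaleDr : right_distributive real_scale +%R.
Proof. by move=> t x y; rewrite /real_scale scalerDr. Qed.

Let real_scaleDl x : {morph real_scale^~ x : s t / s + t}.
Proof. by move=> s t; rewrite /real_scale of_realD scalerDl. Qed.

HB.instance Definition _ := GRing.Zmodule_isLmodule.Build R (@realified R k E)
  real_scaleA real_scale1 real_scaleDr real_scaleDl.

End Realified.

Section HahnBanach.
Context {R : realType} {k : scalar_kind}.
Local Notation K := (scalars R k).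

Lemma real_part_linear (t : R) (a b : K) :
  real_part (of_real t * a + b) = t * real_part a + real_part b.
Proof.
by case: k a b => [//|[a a'] [b b']] /=; rewrite mul0r subr0.
Qed.

(** Multiplying by the inverse of [b - b'] turns a nonzero difference into 1,
    whose real part is not zero. *)
Lemma real_part_inj (b b' : K) :
  (forall a : K, real_part (a * b) = real_part (a * b')) -> b = b'.
Proof.
move=> bb'; apply/subr0_eq/eqP; apply: contraT => d0.
have := real_part_linear (-1) ((b - b')^-1 * b') ((b - b')^-1 * b).
rewrite bb' mulN1r addNr of_realN of_real1 mulN1r addrC -mulrBr mulVf//.
rewrite -of_real1 of_realK => /eqP.
by rewrite oner_eq0.
Qed.

(** Over the complex numbers, f(x) = g(x) - i g(i x). *)
Lemma real_part_of_functional (E : lmodType K) (g : E -> R) :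
  (forall t x y, g ((of_real t : K) *: x + y) = t * g x + g y) ->
  exists2 f : E -> K^o, linear f & forall x, real_part (f x) = g x.
Proof.
case: k E g => /= E g g_lin; first by exists g => // t x y; exact: g_lin.
have i_mul (a b : R) (x : E) : (a +i* b)%C *: x =
    (real_complex R a) *: x + (real_complex R b) *: ('i%C *: x).
  rewrite scalerA -scalerDl; congr (_ *: _).
  by apply/eqP; rewrite eq_complex /=; apply/andP; split; apply/eqP; ring.
exists (fun x : E => (g x +i* - g ('i%C *: x))%C) => // [[a b]] x y.
have gi : g ('i%C *: ((a +i* b)%C *: x + y)) =
    a * g ('i%C *: x) - b * g x + g ('i%C *: y).
  have -> : 'i%C *: ((a +i* b)%C *: x + y) =
      real_complex R a *: ('i%C *: x) +
      (real_complex R (- b) *: x + 'i%C *: y).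
    rewrite scalerDr !scalerA addrA -scalerDl; congr (_ *: _ + _).
    by apply/eqP; rewrite eq_complex /=; apply/andP; split; apply/eqP; ring.
  by rewrite !g_lin mulNr addrA.
rewrite gi i_mul -addrA !g_lin; apply/eqP; rewrite eq_complex /=.
by apply/andP; split; apply/eqP; ring.
Qed.

(** Extension of the functional T y |-> h y from the range of [T].  Stating it
    with an operator instead of a subspace covers norming functionals,
    surjectivity of adjoints and density of ranges at once.  The bound on
    real parts becomes a bound on absolute values because f x can be rotated
    onto its absolute value by a scalar of norm 1. *)
Theorem Hahn_Banach (F : lmodType K) (E : normedModType K)
    (T : {linear F -> E}) (h : {linear F -> K^o}) (c : R) :
  0 <= c -> (forall y, `|h y| <= of_real c * `|T y|) ->
  exists g : dual_space E, (forall y, g (T y) = h y) /\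
    forall x, `|g x| <= of_real c * `|x|.
Proof.
move=> c0 hT; pose p (x : @realified R k E) := c * rnorm (x : E).
have real_part_le (a : K) : real_part a <= rnorm (a : K^o).
  rewrite -(@of_real_le R k) rnormE; case: k a => [a|a] /=.
    exact: ler_norm.
  by rewrite (le_trans _ (normc_ge_Re a))// lecR ler_norm.
have [|||g [g_lin gp gG]] := @real_Hahn_Banach R (@realified R k E) p _ _
  [set z | exists y, z = (T y, real_part (h y))] _.
- by move=> x y; rewrite /p -mulrDr ler_wpM2l// rnormD.
- by move=> t x t0; rewrite /p rnormZ ger0_norm// mulrCA.
- split.
  + by exists 0; rewrite !linear0 -of_real0 of_realK.
  + move=> t _ _ _ _ [x [-> ->]] [y [-> ->]]; exists ((of_real t : K) *: x + y).
    by rewrite !linearP real_part_linear.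
  + move=> _ _ [y [-> ->]]; apply: le_trans (real_part_le _) _.
    rewrite -(@of_real_le R k) of_realM !rnormE; exact: hT.
have [f f_lin fg] := real_part_of_functional g_lin.
have fZ a x : f (a *: x) = a * f x.
  pose lf : {linear E -> K^o} :=
    HB.pack f (GRing.isLinear.Build _ _ _ _ _ f_lin).
  exact: (linearZ_LR lf).
have f_le x : `|f x| <= of_real c * `|x|.
  have [->|fx0] := eqVneq (f x) 0.
    by rewrite normr0 mulr_ge0// -of_real0 of_real_le.
  pose z : K := `|f x| / f x.
  have fzx : f (z *: x) = `|f x|.
    by rewrite fZ divfK.
  have z1 : `|z| = 1 by rewrite normrM normfV normr_id mulfV ?normr_eq0.
  have := gp (z *: x); rewrite -fg fzx -(@of_real_le R k) real_partK//.
  by rewrite of_realM rnormE normrZ z1 mul1r.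
have bf : bounded_functional f.
  by apply/asboolP; split=> //; exists (of_real c).
exists (Dual bf); split=> // y; apply: real_part_inj => a /=.
rewrite -fZ -linearZ fg; apply: gG; exists (a *: y); congr pair.
by rewrite linearZ.
Qed.

End HahnBanach.

(** * The dual of a Banach space *)

Lemma cvg_dist_le (K : numFieldType) (V : normedModType K) (T : Type)
    (F : set_system T) {FF : ProperFilter F} (f : T -> V) (l a : V) (c : K) :
  f @ F --> l -> (\forall t \near F, `|f t - a| <= c) -> `|l - a| <= c.
Proof.
move=> /cvgrPdist_lt fl fa; apply/ler_addgt0Pr => d d0.
have [t [lt_d le_c]] := filter_ex (filterI (fl d d0) fa).
by rewrite -(subrKA (f t)) (le_trans (ler_normD _ _))// [leRHS]addrC lerD// ltW.
Qed.

Section Dual.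
Context {R : realType} {k : scalar_kind}.
Local Notation K := (scalars R k).

(** Extension of a x |-> a |x| from the line spanned by [x]. *)
Lemma norming_functional (E : normedModType K) (x : E) :
  exists g : dual_space E, g x = `|x| /\ `|g| <= 1.
Proof.
have lin_T : linear (fun a : K^o => a *: x).
  by move=> a b c; rewrite scalerDl scalerA.
have lin_h : linear (fun a : K^o => a * `|x| : K^o).
  by move=> a b c; rewrite mulrDl -mulrA.
have [||g [gT g1]] := @Hahn_Banach R k K^o E
  (HB.pack (fun a : K^o => a *: x) (GRing.isLinear.Build _ _ _ _ _ lin_T))
  (HB.pack (fun a : K^o => a * `|x| : K^o)
     (GRing.isLinear.Build _ _ _ _ _ lin_h)) 1.
- exact: ler01.
- by move=> a /=; rewrite of_real1 mul1r [leRHS]normrZ (normrM (a : K)) normr_id.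
exists g; split; first by have := gT 1; rewrite /= scale1r mul1r.
apply: dual_norm_le => y y1; apply: le_trans (g1 y) _.
by rewrite of_real1 mul1r.
Qed.

Lemma dual_separates (E : normedModType K) (x y : E) :
  (forall g : dual_space E, g x = g y) -> x = y.
Proof.
move=> gxy; have [g [gE _]] := norming_functional (x - y).
by apply/subr0_eq/normr0_eq0; rewrite -gE linearB /= gxy subrr.
Qed.

Lemma dual_continuous (E : normedModType K) (g : dual_space E) :
  continuous (g : E -> K^o).
Proof.
apply: (@bounded_linear_continuous _ _ _ (dual_val g : {linear E -> K^o})).
apply/bounded_operatorP.
exact: dual_bounded.
Qed.

Section Complete.
Context {E : completeNormedModType K}.

(** Completeness of the scalar field is inherited from [E]: for nonzero [x] the
    vectors [g x *: x] form a Cauchy filter in [E], and a functional which does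
    not vanish at [x] recovers [g x] from its limit. *)
Lemma dual_pointwise_cvg (F : set_system (dual_space E)) {FF : ProperFilter F}
  (x : E) : cauchy F ->
  exists l : K^o, (fun g : dual_space E => g x : K^o) @ F --> l.
Proof.
move=> cF; have [->|x0] := eqVneq x 0.
  by exists 0; apply: cvg_near_cst; apply: nearW => g; exact: linear0.
have x_gt0 : 0 < `|x| by rewrite normr_gt0.
have : cauchy ((fun g : dual_space E => g x *: x) @ F).
  apply/cauchy_ballP => e e0; move: cF => /cauchy_ballP.
  have d0 : 0 < e / (`|x| * `|x|) by rewrite divr_gt0// mulr_gt0.
  move=> /(_ _ d0) [[A B] [/= FA FB] AB].
  exists ((fun g : dual_space E => g x *: x) @` A,
          (fun g : dual_space E => g x *: x) @` B).
    by split => /=; [apply: filterS FA|apply: filterS FB] => g Ag /=; exists g.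
  move=> [_ _] /= [[g Ag <-] [h Bh <-]].
  have := AB (g, h) (conj Ag Bh); rewrite -!ball_normE/= => gh.
  rewrite -scalerBl normrZ.
  apply: le_lt_trans (_ : `|g - h| * `|x| * `|x| < e).
    by rewrite ler_wpM2r//; exact: (dual_normP (g - h)).
  by rewrite -mulrA -ltr_pdivlMr// mulr_gt0.
move=> /cauchy_cvg /cvg_ex[y gy].
have [phi [phix _]] := norming_functional x.
exists (`|x|^-1 * phi y).
have -> : (fun g : dual_space E => g x : K^o) =
    (fun g : dual_space E => `|x|^-1 * phi (g x *: x)).
  apply/funext => g; rewrite linearZ/= phix mulrC -mulrA mulfV ?mulr1//.
  by rewrite gt_eqF.
apply: cvgMl_tmp; apply: continuous_cvg gy; exact: dual_continuous.
Qed.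

Lemma dual_cauchy_cvg (F : set_system (dual_space E)) :
  ProperFilter F -> cauchy F -> cvg F.
Proof.
move=> FF cF; have [L FL] := choice (fun x => dual_pointwise_cvg x cF).
have near_L (e : K) : 0 < e ->
    \forall g \near F, forall x, `|dual_val g x - L x| <= e * `|x|.
  move=> e0; move: cF => /cauchy_ballP /(_ _ e0) [[A B] [/= FA FB] AB].
  apply: filterS FA => g Ag x; rewrite distrC.
  apply: (cvg_dist_le (FL x)); apply: filterS FB => h Bh; rewrite distrC.
  have := AB (g, h) (conj Ag Bh); rewrite -!ball_normE/= => gh.
  apply: le_trans (dual_normP (g - h) x) _.
  by rewrite ler_wpM2r// ltW.
have L_lin : linear L.
  move=> a x y; apply: (cvg_unique _ (FL _)); first exact: norm_hausdorff.
  have -> : (fun g : dual_space E => g (a *: x + y) : K^o) =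
      (fun g : dual_space E => a * g x : K^o) \+ (fun g : dual_space E => g y).
    by apply/funext => g; exact: dual_linear.
  by apply: cvgD (FL y); apply: cvgMl_tmp; exact: FL.
have bL : bounded_functional L.
  apply/asboolP; split=> //.
  have [g gL] := filter_ex (near_L 1 ltr01).
  exists (`|g| + 1) => x; rewrite -[L x](subKr (g x)).
  rewrite (le_trans (ler_normB _ _))// mulrDl lerD//.
  exact: dual_normP.
apply/cvg_ex; exists (Dual bL); apply/(@cvgrPdist_le _ _ _ F FF id) => e e0.
apply: filterS (near_L e e0) => g gL; rewrite distrC.
apply: dual_norm_le => x x1; apply: le_trans (gL x) _.
by rewrite ler_piMr// ltW.
Qed.

HB.instance Definition _ :=
  Uniform_isComplete.Build (dual_space E) dual_cauchy_cvg.

End Complete.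
End Dual.

(** * Uniform boundedness *)

Section UniformBoundedness.
Context {R : realType} {k : scalar_kind}.
Local Notation K := (scalars R k).

(** For |z| <= 1, the triangle inequality bounds r |g z| by
    |g (r z + x)| + |g x|, so if [g] were small on the whole ball around [x], in
    particular at [x], its norm would be too small. *)
Lemma large_value_in_ball (E : normedModType K) (g : dual_space E) x (r : R) :
  0 < r -> exists y, rnorm (y - x) <= r /\ r * rnorm g <= 2 * rnorm (g y : K^o).
Proof.
move=> r0; apply: contrapT => no_y.
have small y : rnorm (y - x) <= r -> 2 * rnorm (g y : K^o) < r * rnorm g.
  by move=> yx; rewrite ltNge; apply/negP => gy; apply: no_y; exists y.
pose c := (2 * rnorm (g x : K^o) + r * rnorm g) / (2 * r).
suff : `|g| <= of_real c.
  rewrite -rnormE of_real_le ler_pdivlMr ?mulr_gt0//.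
  have := small x; rewrite subrr rnorm0 => /(_ (ltW r0)); lra.
apply: dual_norm_le => z z1; rewrite -[leLHS]rnormE of_real_le.
have z1' : rnorm z <= 1 by rewrite -(@of_real_le R k) rnormE of_real1.
rewrite ler_pdivlMr ?mulr_gt0//.
have := small ((of_real r : K) *: z + x).
rewrite addrK rnormZ gtr0_norm// ler_piMr ?(ltW r0)// => /(_ isT).
have : rnorm (g ((of_real r : K) *: z) : K^o) = r * rnorm (g z : K^o).
  by rewrite linearZ rnormZ gtr0_norm.
have := rnormD (g ((of_real r : K) *: z + x) : K^o) (- g x : K^o).
rewrite rnormN -linearB addrK; lra.
Qed.

(** Gliding hump.  If [S] is unbounded, pick functionals T_n in [S] with
    |T_n| >= 4 n 5^n, and points u_n with |u_(n+1) - u_n| <= 5^-n and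
    2 |T_n u_(n+1)| >= 5^-n |T_n|.  The limit x of (u_n) is at distance at most
    5^-n / 4 from u_(n+1), which leaves |T_n x| >= 5^-n |T_n| / 4 >= n. *)
Theorem uniform_boundedness (E : completeNormedModType K)
    (S : set (dual_space E)) :
  (forall x, exists M : K, forall g, S g -> `|g x| <= M) ->
  exists2 M : K, 0 < M & forall g, S g -> `|g| <= M.
Proof.
move=> ptS; apply: contrapT => unbounded.
pose q : R := 5^-1.
have q_gt0 n : 0 < q ^+ n by rewrite exprn_gt0// invr_gt0.
have /choice[T T_large] (n : nat) :
    exists g, S g /\ 4 * n%:R / q ^+ n <= rnorm g.
  apply: contrapT => no_g; apply: unbounded.
  pose M : R := 4 * n%:R / q ^+ n + 1.
  have M_gt0 : 0 < M by rewrite ltr_pwDr// divr_ge0// ltW.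
  exists (of_real M); first by rewrite -of_real0 of_real_lt.
  move=> g Sg; rewrite -rnormE of_real_le leNgt; apply/negP => gM; apply: no_g.
  by exists g; split=> //; rewrite (le_trans _ (ltW gM))// lerDl.
have /choice[step stepP] (nx : nat * E) :=
  large_value_in_ball (T nx.1) nx.2 (q_gt0 nx.1).
pose u := fix u n := if n is m.+1 then step (m, u m) else 0.
have u_step n : rnorm (u n.+1 - u n) <= q ^+ n by have [] := stepP (n, u n).
have u_large n : q ^+ n * rnorm (T n) <= 2 * rnorm (T n (u n.+1) : K^o).
  by have [] := stepP (n, u n).
(* The sum of q ^+ m for n <= m < n + d, with 5 / 4 = (1 - q)^-1. *)
have u_dist n d : rnorm (u (n + d)%N - u n) <= 5 / 4 * (q ^+ n - q ^+ (n + d)).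
  elim: d => [|d IHd]; first by rewrite addn0 !subrr rnorm0 mulr0.
  have := rnormD (u (n + d).+1 - u (n + d)%N) (u (n + d)%N - u n).
  have := u_step (n + d)%N; rewrite addrA subrK addnS exprS /q; lra.
have u_dist_le n d : rnorm (u (n + d)%N - u n) <= 5 / 4 * q ^+ n.
  by have := u_dist n d; have := q_gt0 (n + d)%N; lra.
have : cauchy (u @ \oo).
  apply: cauchy_exP => e e0.
  have re0 : 0 < real_part e.
    by rewrite -(@of_real_lt R k) of_real0 real_partK ?ltW.
  have : (fun n => q ^+ n) @ \oo --> (0 : R).
    by apply: cvg_expr; rewrite ger0_norm ?invr_ge0// invf_lt1// ltr1n.
  move=> /cvgrPdist_lt/(_ (real_part e / 2)) [|N _ /(_ N (leqnn N))].
    by rewrite divr_gt0.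
  rewrite /= sub0r normrN gtr0_norm// => qN.
  exists (u N), N => // m /= Nm; rewrite -ball_normE/= distrC.
  rewrite -rnormE -[ltRHS]real_partK ?ltW// of_real_lt -(subnKC Nm).
  by have := u_dist_le N (m - N)%N; lra.
move=> /cauchy_cvg /cvg_ex[x ux].
have x_near n : rnorm (x - u n.+1) <= q ^+ n / 4.
  rewrite -(@of_real_le R k) rnormE; apply: cvg_dist_le ux _.
  exists n.+1 => // m /= nm; rewrite -rnormE of_real_le -(subnKC nm).
  by have := u_dist_le n.+1 (m - n.+1)%N; rewrite exprS /q; lra.
have T_x n : n%:R <= rnorm (T n x : K^o).
  have : rnorm (T n (u n.+1 - x) : K^o) <= rnorm (T n) * (q ^+ n / 4).
    apply: le_trans (_ : rnorm (T n) * rnorm (u n.+1 - x) <= _).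
      rewrite -(@of_real_le R k) of_realM !rnormE; exact: dual_normP.
    rewrite ler_wpM2l ?rnorm_ge0// -rnormN opprB; exact: x_near.
  have := rnormD (T n (u n.+1 - x) : K^o) (T n x : K^o).
  rewrite linearB subrK.
  have := u_large n; have [_] := T_large n; rewrite ler_pdivrMr//; lra.
have [M TM] := ptS x.
pose n := (Num.truncn (real_part M)).+1.
have : rnorm (T n x : K^o) <= real_part M.
  have gM : `|T n x| <= M by apply: TM; have [] := T_large n.
  rewrite -(@of_real_le R k) rnormE real_partK//.
  exact: le_trans gM.
by move=> /(le_trans (T_x n)); rewrite leNgt truncnS_gt.
Qed.

Lemma adjointZ (E F : normedModType K) (V : {linear E -> F})
    (bV : bounded_operator V) (a : K) h :
  adjoint bV (a *: h) = a *: adjoint bV h.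
Proof. by apply/dual_eqP. Qed.

(** At [V x], every functional [h] with [adjoint bV h] in the unit ball is
    bounded by the norm of [x]; as [V] is onto, these functionals are pointwise
    bounded on the Banach space [F]. *)
Theorem adjoint_bounded_below (E : normedModType K) (F : completeNormedModType K)
    (V : {linear E -> F}) (bV : bounded_operator V) : range V = setT ->
  exists2 C : K, 0 < C & forall h, `|h| <= C * `|adjoint bV h|.
Proof.
move=> V_surj; have preV y : exists x, V x = y.
  by have [x _ <-] : range V y; [rewrite V_surj|exists x].
have [|C C0 SC] := @uniform_boundedness F [set h | `|adjoint bV h| <= 1].
  move=> y; have [x <-] := preV y; exists `|x| => h /= h1.
  apply: le_trans (dual_normP (adjoint bV h) x) _.
  exact: ler_piMl.
exists C => // h; have [Vh0|Vh0] := eqVneq (adjoint bV h) 0.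
  suff -> : h = 0 by rewrite normr0 mulr_ge0// ltW.
  apply/dual_eqP => y; have [x <-] := preV y.
  exact: (dual_eqP _ _).1 Vh0 x.
have := SC (`|adjoint bV h|^-1 *: h); rewrite /= adjointZ !normrZ normfV normr_id.
rewrite mulVf ?normr_eq0// lexx => /(_ isT).
by rewrite mulrC ler_pdivrMr ?normr_gt0.
Qed.

End UniformBoundedness.

(** * Adjoints in reflexive spaces *)

Lemma bounded_operator_gt0 (K : numFieldType) (E F : normedModType K)
    (V : {linear E -> F}) :
  bounded_operator V -> exists2 M : K, 0 < M & forall x, `|V x| <= M * `|x|.
Proof.
move=> /bounded_operatorP/linear_boundedP/pinfty_ex_gt0[M M0 VM].
by exists M.
Qed.

Section Adjoints.
Context {R : realType} {k : scalar_kind}.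
Local Notation K := (scalars R k).

Lemma bidual_norm (E : normedModType K) (x : E) : `|bidual_embedding x| = `|x|.
Proof.
apply/eqP; rewrite eq_le; apply/andP; split.
  apply: dual_norm_le => g g1; apply: le_trans (dual_normP g x) _.
  exact: ler_piMl.
have [g [gx g1]] := norming_functional x.
have := dual_normP (bidual_embedding x) g; rewrite /= gx normr_id.
move=> /le_trans; apply; exact: ler_piMr (dual_norm_ge0 _) g1.
Qed.

(** A preimage of [h] extends the functional V x |-> h x, which is bounded on
    the range of [V]. *)
Lemma adjoint_surjective (E F : normedModType K) (V : {linear E -> F})
    (bV : bounded_operator V) (C : K) : 0 <= C ->
  (forall x, `|x| <= C * `|V x|) -> range (adjoint bV) = setT.
Proof.
move=> C0 V_below; apply/seteqP; split=> // h _.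
have [||g [gV _]] := @Hahn_Banach R k _ _ V (dual_val h) (real_part (`|h| * C)).
- by rewrite -(@of_real_le R k) of_real0 real_partK mulr_ge0.
- move=> x; rewrite real_partK ?mulr_ge0// -mulrA.
  apply: le_trans (dual_normP h x) _.
  exact: ler_wpM2l (dual_norm_ge0 h) _ _ (V_below x).
by exists g => //; apply/dual_eqP => x; exact: gV.
Qed.

(** If the range stayed at distance [e] from [g], the functional
    adjoint h + a g |-> a would be bounded, and its extension would be the
    evaluation at a point x with h (V x) = 0 for all [h]; then x = 0 by
    injectivity, although g x = 1. *)
Lemma adjoint_range_dense (E F : normedModType K) (V : {linear E -> F})
    (bV : bounded_operator V) (g : dual_space E) (e : K) :
  reflexive_space E -> injective V -> 0 < e ->
  exists h : dual_space F, `|adjoint bV h - g| < e.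
Proof.
move=> E_reflexive V_inj e0; apply: contrapT => far.
have {far} far h : e <= `|adjoint bV h - g|.
  rewrite real_leNgt ?(gtr0_real e0) ?normr_real//; apply/negP => lt_e.
  apply: far.
  by exists h.
pose T0 (z : dual_space F * K^o) := adjoint bV z.1 + z.2 *: g.
have T0_lin : linear T0.
  move=> a [h b] [h' b']; apply/dual_eqP => x.
  change (a * h (V x) + h' (V x) + (a * b + b') * g x =
    a * (h (V x) + b * g x) + (h' (V x) + b' * g x) :> K).
  ring.
have snd_lin : linear (fun z : dual_space F * K^o => z.2) by [].
have [||phi [phiT _]] := @Hahn_Banach R k _ (dual_space E)
  (HB.pack T0 (GRing.isLinear.Build _ _ _ _ _ T0_lin))
  (HB.pack (fun z : dual_space F * K^o => z.2)
     (GRing.isLinear.Build _ _ _ _ _ snd_lin)) (real_part e^-1).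
- by rewrite -(@of_real_le R k) of_real0 real_partK invr_ge0 ltW.
- move=> [h a] /=; rewrite real_partK ?invr_ge0 ?(ltW e0)// ler_pdivlMl//.
  have [->|a0] := eqVneq a 0; first by rewrite normr0 mulr0.
  have -> : T0 (h, a) = - a *: (adjoint bV (- a^-1 *: h) - g).
    rewrite /T0 /= adjointZ scalerBr scalerA mulrNN mulfV// scale1r scaleNr.
    by rewrite opprK.
  by rewrite normrZ normrN mulrC ler_wpM2l.
have [x _ phix] : range (@bidual_embedding R k E) phi.
  by rewrite E_reflexive.
have x0 : x = 0.
  apply: V_inj; rewrite linear0; apply: dual_separates => h.
  have := phiT (h, 0); rewrite /= /T0 /= scale0r addr0 -phix /= => ->.
  by rewrite linear0.
have : dual_val (T0 (0, 1)) 0 = 1 by have := phiT (0, 1); rewrite -phix x0.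
rewrite linear0 => /eqP.
by rewrite eq_sym oner_eq0.
Qed.

(** Choose [g] norming [x] and [h] with the adjoint image of [h] at distance
    at most 1/2 from [g].  Then |x| = g x <= |h| |V x| + |x| / 2, and |h| is at
    most 3/2 times the constant of [adjoint_bounded_below]. *)
Theorem bijective_bounded_below (E : normedModType K)
    (F : completeNormedModType K) (V : {linear E -> F}) :
  reflexive_space E -> bounded_operator V -> bijective V ->
  exists2 C : K, 0 < C & forall x, `|x| <= C * `|V x|.
Proof.
move=> E_reflexive bV V_bij; have V_inj := bij_inj V_bij.
have [|C C0 V'_below] := @adjoint_bounded_below R k E F V bV.
  have [W VK WK] := V_bij.
  by apply/seteqP; split=> // y _; exists (W y).
exists (3 * C) => [|x]; first by rewrite mulr_gt0.
have [g [gx g1]] := norming_functional x.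
have half0 : 0 < 2^-1 :> K by rewrite invr_gt0.
have [h hg] := adjoint_range_dense bV g E_reflexive V_inj half0.
have {}g1 : rnorm g <= 1 by rewrite -(@of_real_le R k) rnormE of_real1.
have {}hg : rnorm (adjoint bV h - g) <= 2^-1.
  rewrite -(@of_real_le R k) rnormE of_realV of_real_nat; exact: ltW.
have h_le : rnorm h <= real_part C * (3 / 2).
  apply: le_trans (_ : rnorm h <= real_part C * rnorm (adjoint bV h)) _.
    rewrite -(@of_real_le R k) of_realM !rnormE real_partK ?(ltW C0)//.
  rewrite ler_wpM2l//; first
    by rewrite -(@of_real_le R k) of_real0 real_partK ltW.
  have := rnormD (adjoint bV h - g) g; rewrite subrK.
  lra.
have gx_le : rnorm x <= rnorm h * rnorm (V x) + 2^-1 * rnorm x.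
  have rnorm_gx : rnorm x = rnorm (g x : K^o) by rewrite gx /rnorm normr_id.
  rewrite [leLHS]rnorm_gx.
  have := rnormD (adjoint bV h x : K^o) (- (adjoint bV h - g) x : K^o).
  rewrite rnormN.
  have -> : adjoint bV h x - (adjoint bV h - g) x = g x.
    by rewrite -[(_ - g) x]/(adjoint bV h x - g x) subKr.
  have : rnorm (adjoint bV h x : K^o) <= rnorm h * rnorm (V x).
    rewrite -(@of_real_le R k) of_realM !rnormE; exact: (dual_normP h (V x)).
  have : rnorm ((adjoint bV h - g) x : K^o) <= rnorm (adjoint bV h - g) * rnorm x.
    rewrite -(@of_real_le R k) of_realM !rnormE.
    exact: (dual_normP (adjoint bV h - g) x).
  have := ler_wpM2r (rnorm_ge0 x) hg; lra.
rewrite -(rnormE x) -(rnormE (V x)) -(real_partK (ltW C0)).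
have -> : 3 = of_real 3 :> K by rewrite of_real_nat.
rewrite -!of_realM of_real_le.
have := ler_wpM2r (rnorm_ge0 (V x)) h_le; lra.
Qed.

Section Predual.
Context {X : completeNormedModType K}.
Hypothesis X_reflexive : reflexive_space X.
Variables (V : {linear dual_space X -> dual_space X}) (bV : bounded_operator V).

Lemma adjoint_onE (g : dual_space X) x : g (adjoint_on bV x) = V g x.
Proof.
have [y _ Vx] : range (@bidual_embedding R k X) (adjoint bV (bidual_embedding x)).
  by rewrite X_reflexive.
have := @xgetPex _ (0 : X)
  [set y | bidual_embedding y = adjoint bV (bidual_embedding x)].
by move=> /(_ (ex_intro _ y Vx)) /dual_eqP /(_ g).
Qed.

Lemma adjoint_on_linear : linear (adjoint_on bV).
Proof.
move=> a x y; apply: dual_separates => g.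
by rewrite linearP /= !adjoint_onE linearP.
Qed.

Definition predual_adjoint : {linear X -> X} :=
  HB.pack (adjoint_on bV) (GRing.isLinear.Build _ _ _ _ _ adjoint_on_linear).

Lemma adjoint_on_bounded : bounded_operator predual_adjoint.
Proof.
have [M M0 VM] := bounded_operator_gt0 bV; exists M => x.
rewrite -(bidual_norm (adjoint_on bV x)); apply: dual_norm_le => g g1 /=.
rewrite adjoint_onE; apply: le_trans (dual_normP _ _) _.
rewrite ler_wpM2r//; apply: le_trans (VM g) _; rewrite ler_piMr// ltW//.
Qed.

End Predual.

End Adjoints.

(** * Expansions in a sequence of vectors *)

Section Expansions.
Context {K : numFieldType} {E : normedModType K}.

Lemma expansion_linear (a : K) (s t : nat -> K^o) (y : nat -> E) n :
  expansion (a *: s + t) y n = a *: expansion s y n + expansion t y n.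
Proof.
rewrite /expansion /series /= scaler_sumr -big_split; apply: eq_bigr => i _ /=.
by rewrite scalerA -scalerDl.
Qed.

Lemma expansion_canonical (y : nat -> E) i n :
  (i < n)%N -> expansion (@canonical_seq K i) y n = y i.
Proof.
move=> i_lt_n; rewrite /expansion /series /= big_mkord.
rewrite (bigD1 (Ordinal i_lt_n))//= /canonical_seq eqxx scale1r big1 ?addr0//.
by move=> j; rewrite -val_eqE /= => /negPf ->; rewrite scale0r.
Qed.

Lemma lin_span_expansion (a : nat -> K) (y : nat -> E) n :
  lin_span y (expansion a y n).
Proof. by exists n, a; rewrite /expansion /series /= big_mkord. Qed.

Lemma lin_span_mem (y : nat -> E) i : lin_span y (y i).
Proof.
by rewrite -[y i](@expansion_canonical y i i.+1)//; exact: lin_span_expansion.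
Qed.

Lemma linear_on_expansion (F : normedModType K) (D : set E) (L : E -> F)
    (y : nat -> E) (a : nat -> K) n :
  linear_subset D -> linear_on D L -> (forall i, D (y i)) ->
  D (expansion a y n) /\ L (expansion a y n) = expansion a (L \o y) n.
Proof.
move=> [D0 Dlin] L_lin Dy.
have L0 : L 0 = 0.
  have := L_lin 1 _ _ D0 D0; rewrite !scale1r addr0 => /eqP.
  by rewrite eq_sym -subr_eq0 addrK => /eqP.
elim: n => [|n [Dn Ln]]; first by rewrite /expansion /series /= !big_geq.
rewrite /expansion /series /= !big_nat_recr//= addrC [X in _ = X]addrC.
by split; [exact: Dlin|rewrite L_lin//; congr (_ + _)].
Qed.

Lemma continuous_expansion (F : normedModType K) (V : {linear E -> F})
    (y : nat -> E) (a : nat -> K) (x : E) : bounded_operator V ->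
  expansion a y @ \oo --> x -> expansion a (V \o y) @ \oo --> V x.
Proof.
move=> /bounded_operatorP/bounded_linear_continuous V_cont ayx.
have -> : expansion a (V \o y) = V \o expansion a y.
  apply/funext => n; rewrite /expansion /series /= linear_sum.
  by apply: eq_bigr => i _; rewrite linearZ.
by apply: continuous_cvg ayx; exact: V_cont.
Qed.

End Expansions.

(** * Images of frames and of atomic decompositions *)

Section Frames.
Context {R : realType} {k : scalar_kind}.
Local Notation K := (scalars R k).
Context {X : completeNormedModType K} {Xd : banachSeqSpace K}.
Implicit Types (g : nat -> dual_space X) (f : X).

Lemma terms_analysis g f : coefficients_in Xd g ->
  terms (analysis Xd g f) = coefficients g f.
Proof. by move=> gX; apply: to_spaceK; exact: gX. Qed.

Lemma analysis_linear g : coefficients_in Xd g -> linear (analysis Xd g).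
Proof.
move=> gX a x y; apply: (@terms_inj _ Xd); rewrite linearP !terms_analysis//.
by apply/funext => i; exact: dual_linear.
Qed.

Lemma analysis_expansion g f : CB_space Xd -> coefficients_in Xd g ->
  expansion (coefficients g f) (canonical_vector Xd) @ \oo --> analysis Xd g f.
Proof. by move=> [_ _ cvg_terms] gX; rewrite -terms_analysis. Qed.

Section Image.
Hypothesis X_reflexive : reflexive_space X.
Variables (V : {linear dual_space X -> dual_space X}) (bV : bounded_operator V).

Lemma coefficients_image g f :
  coefficients (fun i => V (g i)) f = coefficients g (adjoint_on bV f).
Proof. by apply/funext => i; rewrite /coefficients adjoint_onE. Qed.

Lemma analysis_image g f :
  analysis Xd (fun i => V (g i)) f = analysis Xd g (adjoint_on bV f).
Proof. by rewrite /analysis coefficients_image. Qed.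

Lemma coefficients_in_image g :
  coefficients_in Xd g -> coefficients_in Xd (fun i => V (g i)).
Proof. by move=> gX f; rewrite coefficients_image; exact: gX. Qed.

Lemma Bessel_sequence_image g :
  Bessel_sequence Xd g -> Bessel_sequence Xd (fun i => V (g i)).
Proof.
move=> [gX [B B0 gB]]; split; first exact: coefficients_in_image.
have [M M0 VM] := bounded_operator_gt0 (adjoint_on_bounded X_reflexive bV).
exists (B * M) => [|f]; first exact: mulr_gt0.
rewrite analysis_image (le_trans (gB _))// -mulrA ler_wpM2l ?(ltW B0)//.
exact: VM.
Qed.

(** The evaluations embed [X] isometrically in its bidual and intertwine
    [adjoint_on bV] with the adjoint of [V], so a lower bound passes from the
    adjoint to [adjoint_on bV].  For the converse, [V] is the adjoint of
    [adjoint_on bV]. *)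
Lemma surjective_iff_adjoint_bounded_below : range V = setT <->
  exists2 C : K, 0 < C & forall f, `|f| <= C * `|adjoint_on bV f|.
Proof.
split=> [V_surj|[C C0 Vs_below]].
  have [C C0 adj_below] := adjoint_bounded_below bV V_surj.
  exists C => // f; have := adj_below (bidual_embedding f); rewrite bidual_norm.
  have -> : adjoint bV (bidual_embedding f) =
      bidual_embedding (adjoint_on bV f).
    by apply/dual_eqP => g; rewrite /= adjoint_onE.
  by rewrite bidual_norm.
have := adjoint_surjective (adjoint_on_bounded X_reflexive bV) (ltW C0) Vs_below.
move=> adj_surj; apply/seteqP; split=> // h _.
have [g _ <-] : range (adjoint (adjoint_on_bounded X_reflexive bV)) h.
  by rewrite adj_surj.
by exists g => //; apply/dual_eqP => x; rewrite /= adjoint_onE.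
Qed.

Lemma frame_image g : frame Xd g ->
  (frame Xd (fun i => V (g i)) <-> range V = setT).
Proof.
move=> [gX [A [B [A0 B0 gAB]]]].
rewrite surjective_iff_adjoint_bounded_below; split.
  move=> [_ [A' [B' [A'0 _ gA']]]]; exists (B / A') => [|f].
    exact: divr_gt0.
  rewrite mulrAC ler_pdivlMr// mulrC.
  have /andP[/le_trans + _] := gA' f; apply; rewrite analysis_image.
  by have /andP[] := gAB (adjoint_on bV f).
move=> [C C0 V_below].
have [_ [B' B'0 gB']] : Bessel_sequence Xd (fun i => V (g i)).
  apply: Bessel_sequence_image; split=> //.
  by exists B => // f; have /andP[] := gAB f.
split; first exact: coefficients_in_image.
exists (A / C), B'; split=> // [|f]; first exact: divr_gt0.
rewrite gB' andbT analysis_image.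
have /andP[+ _] := gAB (adjoint_on bV f); apply: le_trans.
by rewrite -mulrA ler_wpM2l ?(ltW A0)// ler_pdivrMl.
Qed.

(** If Q' is a left inverse of the analysis operator U V^* of the image, then
    V (Q' U)^* = (Q' U V^* )^* = 1; if V W = 1, then
    W^* Q U V^* = W^* V^* = (V W)^* = 1. *)
Lemma Banach_frame_image g : Banach_frame Xd g ->
  (Banach_frame Xd (fun i => V (g i)) <-> range V = setT /\
    exists2 W : {linear dual_space X -> dual_space X},
      bounded_operator W & forall h, V (W h) = h).
Proof.
move=> [gF [Q bQ QU]]; split.
  move=> [VgF [Q' bQ' Q'U]]; split; first exact/(frame_image gF).
  have [gX [A [B [_ B0 gB]]]] := gF.
  pose U : {linear X -> Xd} := HB.pack (analysis Xd g)
    (GRing.isLinear.Build _ _ _ _ _ (analysis_linear gX)).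
  have bS : bounded_operator (Q' \o U).
    have [M M0 Q'M] := bounded_operator_gt0 bQ'; exists (M * B) => f /=.
    rewrite (le_trans (Q'M _))// -mulrA ler_wpM2l ?(ltW M0)//.
    by have /andP[] := gB f.
  have W_lin : linear (adjoint bS) by move=> a h h'; apply/dual_eqP.
  pose W : {linear dual_space X -> dual_space X} :=
    HB.pack (adjoint bS) (GRing.isLinear.Build _ _ _ _ _ W_lin).
  exists W.
    have [M M0 SM] := bounded_operator_gt0 bS; exists M => h /=.
    apply: dual_norm_le => x x1; apply: le_trans (dual_normP h _) _.
    rewrite mulrC; apply: ler_wpM2r; first exact: dual_norm_ge0.
    by rewrite (le_trans (SM _))// ler_piMr// ltW.
  move=> h; apply/dual_eqP => f.
  by rewrite -(adjoint_onE X_reflexive bV) /= -analysis_image Q'U.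
move=> [V_surj [W bW VW]]; split; first exact/(frame_image gF).
exists (predual_adjoint X_reflexive bW \o Q).
  have [M M0 WM] := bounded_operator_gt0 (adjoint_on_bounded X_reflexive bW).
  have [N N0 QN] := bounded_operator_gt0 bQ; exists (M * N) => c /=.
  by rewrite (le_trans (WM _))// -mulrA ler_wpM2l ?(ltW M0).
move=> f; rewrite /= analysis_image QU; apply: dual_separates => h.
by rewrite adjoint_onE// adjoint_onE// VW.
Qed.

(** Given [h], the operator [L] is synthesis by [h], on the domain where
    the series converges; given [L], the vectors are [L (delta i)], and the
    expansions of [f] are the images under [L] of the partial sums of
    [UVstar f]. *)
Lemma atomic_decomposition_image g : CB_space Xd ->
  (exists y : nat -> X, atomic_decomposition Xd g y) ->
  let UVstar : X -> Xd := analysis Xd g \o adjoint_on bV in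
  let delta := canonical_vector Xd in
  let c (f : X) : nat -> K := coefficients (fun i => V (g i)) f in
  ((exists h : nat -> X, atomic_decomposition Xd (fun i => V (g i)) h) <->
    range V = setT /\ exists (D : set Xd) (L : Xd -> X),
      [/\ linear_subset D, linear_on D L,
          lin_span delta `|` range UVstar `<=` D,
          forall f : X, L (UVstar f) = f &
          forall f : X, L (expansion (c f) delta n) @[n --> \oo] -->
            L (limn (expansion (c f) delta))]).
Proof.
move=> Xd_CB [_ [gF _]] UVstar delta c.
have gX : coefficients_in Xd g by case: gF.
have VgX := coefficients_in_image gX.
have terms_UVstar f : terms (UVstar f) = c f.
  by rewrite /UVstar /= -analysis_image terms_analysis.
have lim_c f : limn (expansion (c f) delta) = UVstar f.
  apply: cvg_lim; first exact: norm_hausdorff.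
  by rewrite /UVstar /= -analysis_image; exact: analysis_expansion.
split=> [[h [VgF hf]]|[V_surj [D [L [Dlin L_lin subD LK L_cvg]]]]]; last first.
  exists (L \o delta); split; first exact/(frame_image gF).
  move=> f; rewrite -[X in _ --> X](LK f) -lim_c.
  have -> : expansion (coefficients (fun i => V (g i)) f) (L \o delta) =
      (fun n => L (expansion (c f) delta n)); last exact: L_cvg.
  apply/funext => n.
  have Ddelta i : D (delta i) by apply: subD; left; exact: lin_span_mem.
  by have [_ ->] := linear_on_expansion (c f) n Dlin L_lin Ddelta.
split; first exact/(frame_image gF).
pose D : set Xd := [set x | cvgn (expansion (terms x) h)].
pose L (x : Xd) := limn (expansion (terms x) h).
have Lin a x y : D x -> D y ->
    expansion (terms (a *: x + y)) h @ \oo --> a *: L x + L y.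
  move=> Dx Dy; rewrite linearP.
  have -> : expansion (a *: terms x + terms y) h =
      (a \*: expansion (terms x) h) \+ expansion (terms y) h.
    by apply/funext => n; exact: expansion_linear.
  by apply: cvgD => //; exact: cvgZl_tmp.
have Dlin : linear_subset D.
  split; last first.
    by move=> a x y Dx Dy; apply/cvg_ex; exists (a *: L x + L y); exact: Lin.
  apply/cvg_ex; exists 0; apply: cvg_near_cst; apply: nearW => n.
  rewrite linear0 /expansion /series /= big1// => i _.
  by rewrite -[LHS]/((0 : K) *: h i) scale0r.
have L_lin : linear_on D L.
  move=> a x y Dx Dy; apply: cvg_lim (Lin a x y Dx Dy); exact: norm_hausdorff.
have [deltaX _ _] := Xd_CB.
have delta_cvg i : expansion (terms (delta i)) h @ \oo --> h i.
  apply: cvg_near_cst; exists i.+1 => // n /= i_lt_n.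
  by rewrite to_spaceK ?expansion_canonical//; exact: deltaX.
have Ddelta i : D (delta i) by apply/cvg_ex; exists (h i).
have Ldelta i : L (delta i) = h i.
  by apply: cvg_lim (delta_cvg i); exact: norm_hausdorff.
have LK f : L (UVstar f) = f.
  rewrite /L terms_UVstar; apply: cvg_lim (hf f); exact: norm_hausdorff.
exists D, L; split=> //.
- move=> x [[n [a ->]]|[f _ <-]].
    have -> : \sum_(i < n) a i *: delta i = expansion a delta n.
      by rewrite /expansion /series /= big_mkord.
    by have [] := linear_on_expansion a n Dlin L_lin Ddelta.
  by apply/cvg_ex; exists f; rewrite terms_UVstar; exact: hf.
- move=> f; rewrite lim_c LK.
  have -> : (fun n => L (expansion (c f) delta n)) = expansion (c f) h.
    apply/funext => n.
    have [_ ->] := linear_on_expansion (c f) n Dlin L_lin Ddelta.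
    by congr expansion; apply/funext.
  exact: hf.
Qed.

End Image.
End Frames.

(** * Riesz bases *)

Section Riesz.
Context {K : numFieldType}.

(** The preimages of the neighbourhoods of [x] generate a proper filter, by
    density, and it is Cauchy by the lower bound; its limit is mapped to
    [x]. *)
Lemma bounded_below_dense_surjective (E : completeNormedModType K)
    (F : normedModType K) (T : {linear E -> F}) (A : K) :
  bounded_operator T -> 0 < A -> (forall c, A * `|c| <= `|T c|) ->
  dense (range T) -> forall x, exists c, T c = x.
Proof.
move=> bT A0 T_below T_dense x.
pose G : set_system E := filter_from (nbhs x) (fun U => T @^-1` U).
have near_T U : nbhs x U -> exists c, U (T c).
  move=> xU; have [|z [Uz [c _ cz]]] := T_dense _ _ (open_interior U).
    by exists x.
  by exists c; apply: interior_subset; rewrite cz.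
have GF : ProperFilter G.
  apply: filter_from_proper; last by move=> U /near_T[c Uc]; exists c.
  apply: filter_from_filter; first by exists setT; exact: filterT.
  by move=> U U' xU xU'; exists (U `&` U') => //; exact: filterI.
have T_G : T @ G --> x by move=> U xU; exists U.
have : cauchy G.
  apply: cauchy_exP => e e0; pose d := A * e / 2.
  have d0 : 0 < d by rewrite divr_gt0// mulr_gt0.
  have xd : nbhs x (ball x d) by exact: nbhsx_ballx.
  have [c0] := near_T _ xd; rewrite -ball_normE/= => c0d.
  exists c0, (ball x d) => // c /=; rewrite -!ball_normE/= => cd.
  rewrite -(ltr_pM2l A0) (le_lt_trans (T_below _))// linearB.
  rewrite -(subrKA x) (le_lt_trans (ler_normD _ _))//.
  have -> : A * e = d + d by rewrite /d -splitr.
  by rewrite ltrD// distrC.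
move=> /cauchy_cvg /cvg_ex[c Gc]; exists c.
apply: (cvg_unique _ _ T_G); first exact: norm_hausdorff.
apply: continuous_cvg Gc.
by move/bounded_operatorP/bounded_linear_continuous : bT; apply.
Qed.

(** The operator is synthesis.  It maps the canonical vectors to [y], so
    density of the span of [y] is density of its range, which is also closed by
    the lower bound. *)
Lemma Riesz_basisP (Xd : banachSeqSpace K) (Y : completeNormedModType K)
    (y : nat -> Y) : CB_space Xd ->
  Riesz_basis Xd y <-> exists T : {linear Xd -> Y},
    [/\ bounded_operator T, exists2 A : K, 0 < A & forall c, A * `|c| <= `|T c|,
        forall x, exists c, T c = x &
        forall c, expansion (terms c) y @ \oo --> T c].
Proof.
move=> [deltaX _ _]; split; last first.
  move=> [T [bT [A A0 T_below] T_surj T_cvg]].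
  have lim_T c : limn (expansion (terms c) y) = T c.
    by apply: cvg_lim (T_cvg c); exact: norm_hausdorff.
  split.
    move=> O [x Ox] O_open; have [c cx] := T_surj x.
    have xO : nbhs (T c) O by rewrite cx; exact: open_nbhs_nbhs.
    have [n _ /(_ n (leqnn n)) On] := T_cvg c O xO.
    by exists (expansion (terms c) y n); split=> //; exact: lin_span_expansion.
  have [B B0 TB] := bounded_operator_gt0 bT.
  exists A, B; split=> // c; rewrite lim_T T_below TB.
  by split=> //; exact: T_cvg.
move=> [y_dense [A [B [A0 B0 y_frame]]]].
pose T0 (c : Xd) := limn (expansion (terms c) y).
have T_cvg c : expansion (terms c) y @ \oo --> T0 c by have [] := y_frame c.
have T_lin : linear T0.
  move=> a c d; apply: cvg_lim; first exact: norm_hausdorff.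
  rewrite linearP.
  have -> : expansion (a *: terms c + terms d) y =
      (a \*: expansion (terms c) y) \+ expansion (terms d) y.
    by apply/funext => n; exact: expansion_linear.
  by apply: cvgD => //; exact: cvgZl_tmp.
pose T : {linear Xd -> Y} :=
  HB.pack T0 (GRing.isLinear.Build _ _ _ _ _ T_lin).
have T_below c : A * `|c| <= `|T c| by have [_ /andP[]] := y_frame c.
have bT : bounded_operator T.
  by exists B => c; have [_ /andP[]] := y_frame c.
have T_delta i : T (canonical_vector Xd i) = y i.
  apply: cvg_lim; first exact: norm_hausdorff.
  apply: cvg_near_cst; exists i.+1 => // n /= i_lt_n.
  by rewrite to_spaceK ?expansion_canonical//; exact: deltaX.
exists T; split=> //; first by exists A.
apply: (bounded_below_dense_surjective bT A0 T_below) => O O0 O_open.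
have [z [Oz [n [a z_sum]]]] := y_dense O O0 O_open.
exists z; split=> //; rewrite z_sum.
exists (\sum_(i < n) a i *: canonical_vector Xd i) => //.
by rewrite linear_sum; apply: eq_bigr => i _; rewrite -(T_delta i) -linearZ.
Qed.

End Riesz.

Lemma Riesz_basis_image (R : realType) (k : scalar_kind)
    (X : completeNormedModType (scalars R k))
    (Xd : banachSeqSpace (scalars R k)) (V : {linear X -> X}) (y : nat -> X) :
  reflexive_space X -> CB_space Xd -> bounded_operator V -> Riesz_basis Xd y ->
  (Riesz_basis Xd (fun i => V (y i)) <-> bijective V).
Proof.
move=> X_reflexive Xd_CB bV /(Riesz_basisP _ Xd_CB).
move=> [T [bT [A A0 T_below] T_surj T_cvg]].
have VT_cvg c := continuous_expansion bV (T_cvg c).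
rewrite (Riesz_basisP _ Xd_CB); split.
  move=> [T' [_ [A' A'0 T'_below] T'_surj T'_cvg]].
  have T'E c : T' c = V (T c).
    by apply: (cvg_unique _ (T'_cvg c) (VT_cvg c)); exact: norm_hausdorff.
  have V_inj : injective V.
    move=> x z Vxz; apply/subr0_eq; have [c cxz] := T_surj (x - z).
    have c0 : `|c| <= 0.
      rewrite -(ler_pM2l A'0) mulr0 (le_trans (T'_below c))//.
      by rewrite T'E cxz linearB Vxz subrr normr0.
    by rewrite -cxz; move: c0; rewrite normr_le0 => /eqP ->; rewrite linear0.
  have /choice[W WK] z : exists x, V x = z.
    by have [c <-] := T'_surj z; exists (T c).
  by exists W => // x; apply: V_inj; rewrite WK.
move=> V_bij; have [C C0 V_below] := bijective_bounded_below X_reflexive bV V_bij.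
have [W VK WK] := V_bij.
exists (V \o T); split=> //.
- have [M M0 VM] := bounded_operator_gt0 bV.
  have [N N0 TN] := bounded_operator_gt0 bT; exists (M * N) => c /=.
  by rewrite (le_trans (VM _))// -mulrA ler_wpM2l ?(ltW M0).
- exists (A / C) => [|c /=]; first exact: divr_gt0.
  by rewrite mulrAC ler_pdivrMr// [leRHS]mulrC (le_trans (T_below c))// V_below.
- by move=> x; have [c cx] := T_surj (W x); exists c; rewrite /= cx.
Qed.

Theorem proposition3p4 (R : realType) (k : scalar_kind)
    (X : completeNormedModType (scalars R k))
    (Xd : banachSeqSpace (scalars R k))
    (X_infinite : infinite_dimensional X) (X_separable : separable_space X)
    (X_reflexive : reflexive_space X) (Xd_RCB : RCB_space Xd) :
  (forall (V : {linear dual_space X -> dual_space X}) (bV : bounded_operator V),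
    [/\ (* (i) *)
        forall g : nat -> dual_space X,
          Bessel_sequence Xd g -> Bessel_sequence Xd (fun i => V (g i)),
        (* (ii) *)
        forall g : nat -> dual_space X, frame Xd g ->
          (frame Xd (fun i => V (g i)) <-> range V = [set: dual_space X]),
        (* (iii) *)
        forall g : nat -> dual_space X, Banach_frame Xd g ->
          (Banach_frame Xd (fun i => V (g i)) <->
            range V = [set: dual_space X] /\
            exists2 W : {linear dual_space X -> dual_space X},
              bounded_operator W & forall h, V (W h) = h) &
        (* (iv) *)
        forall g : nat -> dual_space X,
          (exists y : nat -> X, atomic_decomposition Xd g y) ->
          let UVstar : X -> Xd := analysis Xd g \o adjoint_on bV in
          let delta := canonical_vector Xd in
          let c (f : X) : nat -> scalars R k :=
            coefficients (fun i => V (g i)) f in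
          ((exists h : nat -> X,
              atomic_decomposition Xd (fun i => V (g i)) h) <->
            range V = [set: dual_space X] /\
            exists (D : set Xd) (L : Xd -> X),
              [/\ linear_subset D, linear_on D L,
                  lin_span delta `|` range UVstar `<=` D,
                  forall f : X, L (UVstar f) = f &
                  forall f : X,
                    L (expansion (c f) delta n) @[n --> \oo] -->
                    L (limn (expansion (c f) delta))])]) /\
  (* (v) *)
  (forall (V : {linear X -> X}) (bV : bounded_operator V) (y : nat -> X),
    Riesz_basis Xd y ->
    (Riesz_basis Xd (fun i => V (y i)) <-> bijective V)).
Proof.
have [Xd_CB _] := Xd_RCB; split=> [V bV|V bV y y_Riesz].
  split=> g.
  - exact: Bessel_sequence_image.
  - exact: frame_image.
  - exact: Banach_frame_image.
  - exact: atomic_decomposition_image.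
exact: Riesz_basis_image.
Qed.
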